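(* Let $G$ be a torsion-free abelian group (written additively), let $n>3$, and let $a_1,\ldots,a_n$ be $n$ distinct elements of $G$. Then there is a permutation $b_1,\ldots,b_n$ of $a_1,\ldots,a_n$ such that the $n$ elements $$b_1+2b_2,\ b_2+2b_3,\ \ldots,\ b_{n-1}+2b_n,\ b_n+2b_1$$ are pairwise distinct. *)

(* Defs.v *)
From mathcomp Require Export all_boot all_order all_algebra all_fingroup.

Set Implicit Arguments.
Unset Strict Implicit.
Unset Printing Implicit Defensive.

Import GRing.Theory.
Local Open Scope ring_scope.

Definition torsion_free (G : zmodType) : Prop :=
  forall (x : G) (m : nat), (0 < m)%N -> x *+ m = 0 -> x = 0.

(* Main.v *)
(* The integer relations between the [a i] span a rational subspace;
   since G is torsion-free, projecting modulo it loses no equality, and evaluating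
   the resulting vectors, read as polynomials, at a generic point turns the [a i]
   into distinct rationals satisfying every relation of the [a i].  So it is enough
   to treat rationals, listed increasingly as a_1 < ... < a_n.

   Each a_i + 2 a_(i+1) lies strictly between 3 a_i and 3 a_(i+1), so in this order
   the only possible coincidence is a_n + 2 a_1 = a_i + 2 a_(i+1) for one i.  Then
   exchanging two neighbours among a_(i-1), ..., a_(i+2) removes it without creating
   a new one unless the triple around the exchange is an arithmetic progression; if
   this obstructs every available exchange, four consecutive terms are in progression
   and reversing three consecutive terms works, except for n = 4 and a progression
   a_1, a_2, a_3 with a_4 = a_2 + 2 a_3 - 2 a_1, where a_1, a_3, a_4, a_2 does. *)

Require Import Defs.
From Stdlib Require Import Classical.
From mathcomp Require Import ring lra zify.

Set Implicit Arguments.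
Unset Strict Implicit.
Import Order.TTheory GRing.Theory Num.Theory.
Local Open Scope ring_scope.

(** * Sums along an increasing list in an ordered field *)

Section CyclicSums.
Variable R : realFieldType.
Implicit Types (x y : R) (s t : seq R).

Definition wsum x y : R := x + y *+ 2.

Definition cyclic_wsums s :=
  if s is x :: t then pairmap wsum x (rcons t x) else [::].

Lemma size_cyclic_wsums s : size (cyclic_wsums s) = size s.
Proof. by case: s => //= x t; rewrite size_pairmap size_rcons. Qed.

Lemma nth_cyclic_wsums s i : (i < size s)%N ->
  nth 0 (cyclic_wsums s) i = wsum (nth 0 s i) (nth 0 s (i.+1 %% size s)).
Proof.
case: s => //= x t; rewrite ltnS => le_it.
rewrite (nth_pairmap 0) ?size_rcons ?ltnS // -rcons_cons !nth_rcons /= ltnS le_it.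
case: ltngtP le_it => // [lt_it|->] _; last by rewrite modnn.
by rewrite modn_small.
Qed.

(** The free bound [z] carries the induction: it becomes [wsum x y], which is below [3 * y]. *)
Lemma pairmap_wsum_lt x t z : path <%R x t -> z <= 3 * x -> path <%R z (pairmap wsum x t).
Proof.
elim: t x z => //= y t IHt x z /andP[lt_xy y_t] le_zx.
by rewrite IHt ?andbT // /wsum; lra.
Qed.

Lemma pairmap_wsum_gt x t :
  path <%R x t -> {in pairmap wsum x t, forall e, e < 3 * last x t}.
Proof.
elim: t x => //= y t IHt x /andP[lt_xy y_t] e.
rewrite inE => /predU1P[->|]; last exact: IHt.
have le_yt : y <= last y t.
  have := mem_last y t; rewrite inE => /predU1P[->//|].
  by move/(allP (order_path_min lt_trans y_t))/ltW.
by rewrite /wsum; lra.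
Qed.

Lemma pairmap_wsum_uniq x t : path <%R x t -> uniq (pairmap wsum x t).
Proof.
move=> /pairmap_wsum_lt/(_ (lexx _))/path_sorted; exact: sorted_uniq lt_trans ltxx _.
Qed.

(* Reordering a block of an increasing cycle strictly between its ends [u] and [z]
   only affects sums in the interval [3u, 3z]. *)
Lemma uniq_cyclic_wsums_block p u mid z q (c := wsum (last z q) (head u p)) :
    sorted <%R (rcons p u) -> sorted <%R (z :: q) ->
    uniq (c :: pairmap wsum u (rcons mid z)) ->
    all (fun e => 3 * u <= e <= 3 * z) (c :: pairmap wsum u (rcons mid z)) ->
  uniq (cyclic_wsums (rcons p u ++ mid ++ z :: q)).
Proof.
have [x [t def_p]] : exists x t, rcons p u = x :: t by case: (p) => [|x t]; do 2 eexists.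
have -> : c = wsum (last z q) x by rewrite /c; case: (p) def_p => [|? ?] [->].
have u_eq : last x t = u by rewrite -(last_cons x) -def_p last_rcons.
rewrite def_p [sorted _ (_ :: _)]/= [cyclic_wsums _]/= => {c def_p}.
set c := wsum _ _ => x_p z_q uniq_cL /allP range_cL.
have -> : pairmap wsum x (rcons (t ++ mid ++ z :: q) x) =
    pairmap wsum x t ++ pairmap wsum u (rcons mid z) ++ pairmap wsum z q ++ [:: c].
  rewrite -cat_rcons !rcons_cat !pairmap_cat last_rcons u_eq.
  by rewrite -(cats1 q) pairmap_cat.
(* Moving [c] next to the block leaves sums below [3 * u], then in [[3 * u, 3 * z]], then above
   [3 * z]. *)
rewrite -(perm_uniq (_ : perm_eq (pairmap wsum x t ++
  (c :: pairmap wsum u (rcons mid z)) ++ pairmap wsum z q) _)); last first.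
  by rewrite perm_cat2l catA cats1 perm_sym perm_rcons.
have gtA := pairmap_wsum_gt x_p.
have /(order_path_min lt_trans)/allP ltB := pairmap_wsum_lt z_q (lexx _).
rewrite cat_uniq pairmap_wsum_uniq // cat_uniq [uniq (c :: _)]uniq_cL.
rewrite pairmap_wsum_uniq // andbT !andTb.
apply/andP; split; apply/hasPn => e.
  have := range_cL c (mem_head _ _).
  rewrite mem_cat => c_range /orP[/range_cL|/ltB] /= e_range;
    apply/negP => /gtA; rewrite u_eq; lra.
by move=> /ltB lt_ze; apply/negP => /range_cL; lra.
Qed.

Lemma mem_pairmap_split (T : Type) (S : eqType) (f : T -> T -> S) (x : T) (t : seq T) c :
  c \in pairmap f x t -> exists p v w q, x :: t = p ++ [:: v, w & q] /\ c = f v w.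
Proof.
elim: t x => //= y t IHt x; rewrite inE => /predU1P[->|/IHt[p [v [w [q [-> ->]]]]]].
  by exists [::], x, y, t.
by exists (x :: p), v, w, q.
Qed.

Lemma head_sorted_le p u s : sorted <%R (rcons p u ++ s) -> head u p <= u.
Proof.
case: p => //= x p; rewrite cat_path.
case/andP=> /(order_path_min lt_trans)/allP/(_ u) lt_xu _.
by rewrite ltW ?lt_xu // mem_rcons mem_head.
Qed.

Lemma last_sorted_ge s z q : sorted <%R (s ++ z :: q) -> z <= last z q.
Proof.
case/cat_sorted2 => _ /= /(order_path_min lt_trans)/allP lt_zq.
by have := mem_last z q; rewrite inE => /predU1P[->//|/lt_zq/ltW].
Qed.

Definition good_order s := exists2 b, perm_eq b s & uniq (cyclic_wsums b).

Lemma good_order_block p u mid mid' z q (c := wsum (last z q) (head u p)) :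
    sorted <%R (rcons p u ++ mid ++ z :: q) -> perm_eq mid' mid ->
    uniq (c :: pairmap wsum u (rcons mid' z)) ->
    all (fun e => 3 * u <= e <= 3 * z) (c :: pairmap wsum u (rcons mid' z)) ->
  good_order (rcons p u ++ mid ++ z :: q).
Proof.
move=> /cat_sorted2[pu_sorted /cat_sorted2[_ zq_sorted]] mid'P uniq_c range_c.
exists (rcons p u ++ mid' ++ z :: q); first by rewrite perm_cat2l perm_cat2r.
exact: uniq_cyclic_wsums_block.
Qed.

Lemma sorted_good_order s : sorted <%R s -> (3 < size s)%N -> good_order s.
Proof.
case: s => // x t xt_sorted gt3.
have [c_in|nc] := boolP (wsum (last x t) x \in pairmap wsum x t); last first.
  exists (x :: t) => //=.
  by rewrite -cats1 pairmap_cat /= cats1 rcons_uniq nc pairmap_wsum_uniq.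
have [p [v [w [q [def_xt]]]]] := mem_pairmap_split c_in.
have -> : wsum (last x t) x = wsum (last w q) (head v p).
  rewrite -(last_cons x) def_xt last_cat.
  by case: (p) def_xt => [|? ?] [->].
move: xt_sorted gt3 c_in; rewrite def_xt => + + _; move=> {x t def_xt}.
have head_rcons r e f : head e (rcons r f) = head f r :> R by case: r.
case/lastP: p => [|p u].
  case: q => [|y [|z q]] //= s_sorted _ c_eq.
  have /= le_zq := @last_sorted_ge [:: v; w; y] _ _ s_sorted.
  have /and4P[lt_vw lt_wy lt_yz _] := s_sorted.
  apply: (@good_order_block [::] v [:: w; y] [:: y; w] z q) => //.
  - by rewrite (perm_catC [:: y] [:: w]).
  - by rewrite /= c_eq !inE; move: c_eq; rewrite /wsum; lra.
  - by rewrite /= c_eq; move: c_eq; rewrite /wsum; lra.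
rewrite head_rcons => s_sorted gt3.
have le_xu := head_sorted_le s_sorted.
have : sorted <%R (p ++ [:: u, v, w & q]) by rewrite -cat_rcons.
case/cat_sorted2=> _ /= /and3P[lt_uv lt_vw].
case: q s_sorted gt3 => [|z q] s_sorted gt3 /=.
  (* The first term would be the mean of [v] and [w], yet it is at most [u < v]. *)
  by rewrite /wsum; lra.
case/andP=> lt_wz z_q c_eq.
have swap e f : perm_eq [:: e; f] [:: f; e] by rewrite (perm_catC [:: e] [:: f]).
have rev3 e f g : perm_eq [:: e; f; g] [:: g; f; e].
  by rewrite (_ : [:: e; f; g] = rev [:: g; f; e]) ?perm_rev.
(* Exchanging [v] and [w] can only create the clash [u + 2w = w + 2v]. *)
have [ap_uvw|nap_uvw] := eqVneq (u + w) (v *+ 2); last first.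
  apply: (@good_order_block p u [:: v; w] [:: w; v] z q) => //.
  - by rewrite /= c_eq !inE; move: c_eq nap_uvw; rewrite /wsum neq_lt => ? /orP[]; lra.
  - by rewrite /= c_eq; move: c_eq; rewrite /wsum; lra.
case: q s_sorted gt3 z_q c_eq => [|y q] s_sorted gt3 /= z_q c_eq.
  case/lastP: p s_sorted gt3 c_eq le_xu => [|p t] s_sorted gt3 /= c_eq le_xu.
    (* Up to scaling and translation the terms are 0, 1, 2, 5; the order 0, 2, 5, 1 has sums 4, 12,
       7, 1. *)
    exists [:: u; w; z; v].
      by rewrite /= perm_cons (perm_catC [:: w; z] [:: v]).
    by rewrite /= !inE; move: c_eq; rewrite /wsum; lra.
  move: s_sorted c_eq; rewrite head_rcons cat_rcons => s_sorted c_eq.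
  have le_xt := head_sorted_le s_sorted.
  have : sorted <%R (p ++ [:: t, u, v, w & [:: z]]) by rewrite -cat_rcons.
  case/cat_sorted2=> _ /= /andP[lt_tu _].
  have [ap_tuv|nap_tuv] := eqVneq (t + v) (u *+ 2); last first.
    apply: (@good_order_block p t [:: u; v] [:: v; u] w [:: z]) => //.
    - by rewrite /= c_eq !inE; move: c_eq nap_tuv; rewrite /wsum neq_lt => ? /orP[]; lra.
    - by rewrite /= c_eq; move: c_eq; rewrite /wsum; lra.
  (* With [t, u, v, w] as 0, 1, 2, 3, the new sums are 6, 7, 4, [1 + 2z] and [c] is 8; [c_eq] and
     [le_xt] give [z >= 8]. *)
  apply: (@good_order_block p t [:: u; v; w] [:: w; v; u] z [::]) => //.
  - by rewrite /= c_eq !inE; move: c_eq; rewrite /wsum; lra.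
  - by rewrite /= c_eq; move: c_eq; rewrite /wsum; lra.
have /andP[lt_zy _] := z_q.
have [ap_vwz|nap_vwz] := eqVneq (v + z) (w *+ 2); last first.
  move: s_sorted; rewrite -cat_rcons => s_sorted.
  apply: (@good_order_block (rcons p u) v [:: w; z] [:: z; w] y q) => //.
  - rewrite /= head_rcons c_eq !inE; move: c_eq nap_vwz.
    by rewrite /wsum neq_lt => ? /orP[]; lra.
  - by rewrite /= head_rcons c_eq; move: c_eq; rewrite /wsum; lra.
(* With [u, v, w, z] as 0, 1, 2, 3, the new sums are 6, 7, 4 and [1 + 2y > 7], while [c] is 5. *)
apply: (@good_order_block p u [:: v; w; z] [:: z; w; v] y q) => //.
- by rewrite /= c_eq !inE; move: c_eq; rewrite /wsum; lra.
- by rewrite /= c_eq; move: c_eq; rewrite /wsum; lra.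
Qed.
End CyclicSums.

Lemma sum_mulrz_delta (G : zmodType) (I : finType) (a : I -> G) i0 :
  \sum_i a i *~ (i == i0)%:Z = a i0.
Proof. by rewrite (bigD1 i0) //= eqxx big1 ?addr0 // => i /negPf->. Qed.

(** The naturals below [size p] outnumber the roots of [p]. *)
Lemma poly_nonroot (R : numDomainType) (p : {poly R}) : p != 0 -> exists x, ~~ root p x.
Proof.
move=> nz_p; pose rs := [seq k%:R : R | k <- iota 0 (size p)].
have : ~~ all (root p) rs.
  apply/negP => /(max_poly_roots nz_p); rewrite size_map size_iota ltnn.
  by rewrite map_inj_uniq ?iota_uniq => [/(_ isT)|? ? /eqP]; rewrite ?eqr_nat // => /eqP.
by case/allPn => x _; exists x.
Qed.

(** Any point off the roots of the product of all differences will do. *)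
Lemma separating_point (R : numDomainType) (I : finType) (P : I -> {poly R}) :
  injective P -> exists x, injective (fun i => (P i).[x]).
Proof.
move=> P_inj.
have [|x] := @poly_nonroot _ (\prod_i \prod_(j | j != i) (P i - P j)).
  apply/prodf_neq0 => i _; apply/prodf_neq0 => j ne_ji.
  by rewrite subr_eq0 (inj_eq P_inj) eq_sym.
rewrite /root horner_prod => /prodf_neq0 nz; exists x => i j eq_ij.
apply/eqP/negPn/negP => ne_ij.
have := nz i isT; rewrite horner_prod => /prodf_neq0/(_ j); rewrite eq_sym => /(_ ne_ij).
by rewrite !hornerE /= eq_ij subrr eqxx.
Qed.

(** * Rational relations and a rational model of the family *)

Section Relations.
Variables (G : zmodType) (tfG : torsion_free G) (n : nat) (a : 'I_n -> G).

(** Rational multiples need not exist in [G], so some positive multiple of [v] has to be an integer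
    relation. *)
Definition rational_relation (v : 'rV[rat]_n) :=
  exists (m : nat) (z : 'I_n -> int),
    [/\ (0 < m)%N, forall i, v 0 i * m%:R = (z i)%:~R & \sum_i a i *~ z i = 0].

Lemma rational_relation_lin k (u : 'rV[rat]_k) (M : 'M[rat]_(k, n)) :
  (forall i, rational_relation (row i M)) -> rational_relation (u *m M).
Proof.
move=> relM; rewrite mulmx_sum_row.
apply: (big_ind rational_relation) =>
  [|v w [m [z [m_gt0 vz az]]] [m' [z' [m'_gt0 wz' az']]]|i _].
- exists 1%N, (fun=> 0); split=> // [i|]; first by rewrite mxE mul0r.
  by rewrite big1 // => i _; rewrite mulr0z.
- exists (m * m')%N, (fun i => z i * m'%:Z + z' i * m%:Z); split=> [|i|].
  + by rewrite muln_gt0 m_gt0.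
  + by rewrite mxE intrD !intrM -vz -wz' natrM; ring.
  + under eq_bigr do rewrite mulrzDr !mulrzA.
    by rewrite big_split /= -!mulrz_suml az az' !mul0rz addr0.
- have [m [z [m_gt0 vz az]]] := relM i.
  move: (u 0 i) => r; exists (`|denq r| * m)%N, (fun j => z j * numq r); split=> [|j|].
  + by rewrite muln_gt0 m_gt0 absz_gt0 denq_neq0.
  + by rewrite mxE intrM -vz numqE natrM [`|_|%:R]pmulrn absz_denq; ring.
  + under eq_bigr do rewrite mulrzA.
    by rewrite -mulrz_suml az mul0rz.
Qed.

(** A relation outside the row space, added as a row, raises the rank, which is at most [n]; [d]
    bounds the codimension left. *)
Lemma maximal_relation_matrix : exists k (M : 'M[rat]_(k, n)),
  (forall i, rational_relation (row i M)) /\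
  (forall v, rational_relation v -> (v <= M)%MS).
Proof.
suff IH d k (M : 'M[rat]_(k, n)) : (n - \rank M <= d)%N ->
    (forall i, rational_relation (row i M)) -> exists k (M : 'M[rat]_(k, n)),
  (forall i, rational_relation (row i M)) /\
  (forall v, rational_relation v -> (v <= M)%MS).
  by apply: (IH n 0%N 0) => [|[]//]; exact: leq_subr.
elim: d k M => [|d IHd] k M le_d relM;
  have [[v [rel_v v_notin]]|maxM] :=
    classic (exists v, rational_relation v /\ ~~ (v <= M)%MS).
- have /negP[] := v_notin; apply: submx_full; rewrite /row_full eqn_leq rank_leq_col.
  by rewrite -subn_eq0 -leqn0.
- by exists k, M; split=> // v rel_v; apply/negPn/negP => v_notin; apply: maxM; exists v.
- apply: (IHd _ (col_mx M v)).
    have ltM : (\rank M < \rank (col_mx M v))%N.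
      have := submx_refl (col_mx M v); rewrite col_mx_sub => /andP[leM _].
      by rewrite (ltn_leqif (mxrank_leqif_sup leM)) col_mx_sub submx_refl.
    have := rank_leq_col (col_mx M v); lia.
  move=> i; rewrite -[i]splitK; case: split => j /=; first by rewrite rowKu.
  by rewrite rowKd row_id.
- by exists k, M; split=> // v rel_v; apply/negPn/negP => v_notin; apply: maxM; exists v.
Qed.

Lemma rational_model : injective a -> exists x : 'I_n -> rat,
  injective x /\ forall z : 'I_n -> int, \sum_i a i *~ z i = 0 -> \sum_i x i *~ z i = 0.
Proof.
move=> a_inj; have [k [M [relM maxM]]] := maximal_relation_matrix.
(* [P i] encodes the class of the [i]-th basis vector modulo the relations. *)
pose P i := rVpoly (row i (cokermx M)).
have [|t t_inj] := @separating_point _ _ P.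
  move=> i j /(can_inj rVpolyK) eq_ij; apply: a_inj; apply/eqP; rewrite -subr_eq0.
  (* Equal classes make the difference of two basis vectors a relation, so some [m > 0] kills
     [a i - a j]. *)
  have : ((delta_mx 0 i - delta_mx 0 j : 'rV[rat]_n) <= M)%MS.
    by rewrite submxE mulmxBl -!rowE eq_ij subrr.
  case/submxP=> u def_u.
  have [m [z [m_gt0 def_z az0]]] := rational_relation_lin u relM.
  have def_z' l : z l = ((l == i)%:Z - (l == j)%:Z) * m%:Z.
    apply/eqP; rewrite -(eqr_int rat) -def_z -def_u !mxE !eqxx /=.
    by rewrite intrM intrB.
  apply/eqP/(tfG m_gt0); rewrite -az0.
  under [RHS]eq_bigr do rewrite def_z' mulrzA mulrzBr.
  by rewrite -mulrz_suml sumrB !sum_mulrz_delta pmulrn.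
exists (fun i => (P i).[t]); split=> // z az0.
have /maxM : rational_relation (\row_i (z i)%:~R).
  by exists 1%N, z; split=> // i; rewrite mxE mulr1.
rewrite submxE => /eqP zM0.
have : (rVpoly ((\row_i (z i)%:~R) *m cokermx M)).[t] = 0 by rewrite zM0 linear0 horner0.
rewrite mulmx_sum_row linear_sum horner_sum => {2}<-; apply: eq_bigr => i _.
by rewrite linearZ /= hornerZ mxE -mulrzl.
Qed.
End Relations.

(* [ordS i] is the cyclic successor of [i] in ['I_n], so that the last index
   is followed by the first one. *)
Theorem theorem1p3 (G : zmodType) (tfG : torsion_free G)
    (n : nat) (n_gt3 : (3 < n)%N) (a : 'I_n -> G) (a_inj : injective a) :
  exists s : 'S_n,
    injective (fun i : 'I_n => a (s i) + a (s (ordS i)) *+ 2).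
Proof.
have [x [x_inj x_rel]] := rational_model tfG a_inj.
have x_wsum i j k l : a i + a j *+ 2 = a k + a l *+ 2 ->
    wsum (x i) (x j) = wsum (x k) (x l).
  move=> /eqP; rewrite -subr_eq0 => /eqP eq_a.
  (* Deltas are added, so [i, j, k, l] may coincide. *)
  pose z m : int := (m == i)%:Z + (m == j)%:Z *+ 2 - ((m == k)%:Z + (m == l)%:Z *+ 2).
  have sumz (H : zmodType) (y : 'I_n -> H) :
      \sum_m y m *~ z m = y i + y j *+ 2 - (y k + y l *+ 2).
    under eq_bigr do rewrite /z mulrzBr !mulrzDr.
    by rewrite sumrB !big_split /= !sum_mulrz_delta -!mulr2n.
  by have := x_rel z; rewrite !sumz eq_a => /(_ erefl)/eqP; rewrite subr_eq0 => /eqP.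
pose t := [tuple x i | i < n].
have t_uniq : uniq t by rewrite map_inj_uniq // enum_uniq.
have [||b b_sort b_uniq] := @sorted_good_order _ (sort <=%R t).
- by rewrite lt_sorted_uniq_le sort_uniq t_uniq sort_le_sorted.
- by rewrite size_sort size_tuple.
have /tuple_permP[s def_b] : perm_eq b t by rewrite (perm_trans b_sort) ?perm_sort.
have size_b : size b = n by rewrite def_b size_tuple.
have nth_b (i : 'I_n) : nth 0 b i = x (s i).
  by rewrite def_b -tnth_nth !tnth_mktuple.
exists s => i j /x_wsum eq_x; apply/ord_inj/eqP.
rewrite -(nth_uniq 0 _ _ b_uniq) ?size_cyclic_wsums ?size_b //.
rewrite !nth_cyclic_wsums ?size_b // !nth_b.
(* The value of [ordS i] is [i.+1 %% n], the index in [nth_cyclic_wsums]. *)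
by rewrite (nth_b (ordS i)) (nth_b (ordS j)) eq_x.
Qed.
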